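(* The second-price auction (SPA) is optimistic auto-bidding incentive compatible (OAIC) in the setting of two uniform bidding tCPA auto-bidders. That is: let there be two advertisers $A=\{1,2\}$ and $n\ge1$ queries with values $v_{i,j}>0$. For each advertiser $i\in\{1,2\}$ with true target $T_i>0$, every fixed reported target of the other advertiser (a positive real), and every report $0<T_i'\le T_i$, $$\max_{\pi\in\Pi(T_i)^{\mathrm{Eq}}}\mathrm{LW}_i(\pi)\ \ge\ \max_{\pi\in\Pi(T_i')^{\mathrm{Eq}}}\mathrm{LW}_i(\pi),$$ where $\Pi(\cdot)^{\mathrm{Eq}}$ is the set of uniform-bidding equilibrium allocations.
   Context: Setting. There are two advertisers $1,2$ and queries $Q=\{1,\dots,n\}$; $v_{i,j}>0$ is the value of bidder $i$ for query $j$. Each advertiser $i$ reports a target to its own auto-bidder. Uniform bidding: with reported targets $(S_1,S_2)$, bidder $i$ chooses a single multiplier $\mu_i\ge1$ and bids $b_{i,j}=\mu_iS_iv_{i,j}$ on every query $j$. Second-price auction: each query $j$ is sold separately to the highest bidder on $j$, and ties are won by bidder 1; the winner pays the other bidder's bid on $j$. $\pi_{i,j}\in\{0,1\}$ indicates whether $i$ wins $j$, and $c_{i,j}$ is the price $i$ pays for $j$ when winning it. Uniform-bidding auto-bidder equilibrium with reported targets $(S_1,S_2)$: multipliers $\mu_1,\mu_2\ge1$, with resulting allocation $\pi$ and costs $c$, such that for each bidder $i$: (1) tCPA constraint: $\sum_{j}\pi_{i,j}c_{i,j}\le S_i\sum_j\pi_{i,j}v_{i,j}$; (2) stability: for every deviation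 of $i$ to uniform bids $b'_{i,j}=\alpha'v_{i,j}$ with $\alpha'>0$, the other bidder's bids being unchanged, with resulting allocation $\pi'$ and costs $c'$, at least one of the following holds: $S_i\sum_j\pi'_{i,j}v_{i,j}\le S_i\sum_j\pi_{i,j}v_{i,j}$, or $\sum_j\pi'_{i,j}c'_{i,j}>S_i\sum_j\pi'_{i,j}v_{i,j}$. With the other advertiser's report fixed, $\Pi(S)^{\mathrm{Eq}}$ denotes the set of allocations of uniform-bidding auto-bidder equilibria when advertiser $i$ reports $S$. $\mathrm{LW}_i(\pi)=T_i\sum_{j}\pi_{i,j}v_{i,j}$, where $T_i$ is the true target of $i$ (used on both sides). Convention: the maximum over an empty set is $-\infty$. *)

(* Defs.v *)
(* MathComp-Analysis *)
From HB Require Import structures.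
From mathcomp Require Import all_boot all_order all_algebra.
From mathcomp Require Import all_classical all_reals.

Set Implicit Arguments.
Unset Strict Implicit.
Unset Printing Implicit Defensive.

Import Order.TTheory GRing.Theory Num.Theory.
Local Open Scope classical_set_scope.
Local Open Scope ring_scope.

(* Advertisers 1 and 2 are [ord0] and [ord_max] in ['I_2]. *)
Definition other (i : 'I_2) : 'I_2 := rev_ord i.

Section SecondPriceAuction.
Variables (R : realType) (n : nat).
Implicit Types (b v : 'M[R]_(2, n)) (S mu : 'I_2 -> R) (i : 'I_2).
Implicit Type (pi : 'M[bool]_(2, n)).

(* Ties are won by the first advertiser. *)
Definition spa_alloc b : 'M[bool]_(2, n) :=
  \matrix_(i < 2, j < n)
    (if i == ord0 then b (other i) j <= b i j else b (other i) j < b i j).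

Definition spa_price b : 'M[R]_(2, n) :=
  \matrix_(i < 2, j < n) b (other i) j.

Definition won_value v pi i : R := \sum_(j < n | pi i j) v i j.

Definition spa_cost b i : R := \sum_(j < n | spa_alloc b i j) spa_price b i j.

Definition uniform_bids v S mu : 'M[R]_(2, n) :=
  \matrix_(i < 2, j < n) (mu i * S i * v i j).

Definition deviate v b i (a : R) : 'M[R]_(2, n) :=
  \matrix_(k < 2, j < n) (if k == i then a * v k j else b k j).

Definition tcpa_feasible v S b i : Prop :=
  spa_cost b i <= S i * won_value v (spa_alloc b) i.

Definition stable v S b i : Prop :=
  forall a : R, 0 < a ->
    let b' := deviate v b i a in
    S i * won_value v (spa_alloc b') i <= S i * won_value v (spa_alloc b) i
    \/ spa_cost b' i > S i * won_value v (spa_alloc b') i.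

Definition uniform_equilibrium v S mu : Prop :=
  let b := uniform_bids v S mu in
  forall i, [/\ 1 <= mu i, tcpa_feasible v S b i & stable v S b i].

Definition eq_allocs v S : set 'M[bool]_(2, n) :=
  [set pi | exists2 mu : 'I_2 -> R,
     uniform_equilibrium v S mu & pi = spa_alloc (uniform_bids v S mu)].

(* Advertiser [i] reports [s], its opponent reports [t]. *)
Definition reports i (s t : R) : 'I_2 -> R := fun k => if k == i then s else t.

(* [T] is the true target of [i], whatever [i] reports. *)
Definition LW v i (T : R) pi : R := T * won_value v pi i.

(* The set of allocations is finite; the maximum over the empty set is [-oo]. *)
Definition max_over (A : set 'M[bool]_(2, n)) (f : 'M[bool]_(2, n) -> R)
    : \bar R :=
  \big[maxe/-oo%E]_(pi in A) (f pi)%:E.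

End SecondPriceAuction.

(* Main.v *)
(* Let bidder i bid x v_i and its opponent k bid y v_k. With the queries sorted
   by the ratio v_k / v_i into levels of equal ratio, i wins the levels of ratio
   below x / y, whatever the bids. For given targets s of i and t of k, the pairs
   (x, y) that make the first l levels an equilibrium are the solutions of a
   system of linear inequalities; eliminating x and y leaves a lower bound on s
   (the predicate [low]) and an upper bound on s. The lower bound for l.+1 never
   exceeds the upper bound for l, so the largest l that satisfies its lower bound
   always gives an equilibrium. Raising s preserves the lower bounds, hence can
   only increase this largest l. *)
Require Import Defs.
From mathcomp Require Import all_boot all_order all_algebra.
From mathcomp Require Import all_classical all_reals.
From mathcomp Require Import ring lra zify.
Import Order.TTheory GRing.Theory Num.Theory.
Local Open Scope ring_scope.

(** * Linear inequalities in the two bids, and their elimination *)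

(** One step of Fourier-Motzkin elimination with mixed bounds. Only [p] and [u] may coincide, which
    forces [y = u]; so [u] itself is taken whenever it lies below [w], and a midpoint otherwise. *)
Lemma between_mixed (R : realFieldType) (p q1 q2 u w : R) :
  p <= u -> p < w -> q1 < u -> q1 < w -> q2 < u -> q2 < w ->
  exists y, [/\ p <= y, q1 < y, q2 < y, y <= u & y < w].
Proof.
move=> pu pw q1u q1w q2u q2w; have [uw|wu] := ltP u w; first by exists u; split.
have mw : Num.max p (Num.max q1 q2) < w by rewrite !gt_max pw q1w q2w.
have pm : p <= Num.max p (Num.max q1 q2) by rewrite le_max lexx.
have q1m : q1 <= Num.max p (Num.max q1 q2) by rewrite !le_max lexx orbT.
have q2m : q2 <= Num.max p (Num.max q1 q2) by rewrite !le_max lexx !orbT.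
move: (Num.max _ _) mw pm q1m q2m => M mw pm q1m q2m.
by exists ((M + w) / 2); split; lra.
Qed.

(* Level h has total value [alpha h] for bidder i and [rho h * alpha h] for the
   opponent. *)
Section Levels.
Variables (R : realFieldType) (m : nat) (alpha rho : nat -> R).
Hypothesis alpha_gt0 : forall h, (h < m)%N -> 0 < alpha h.
Hypothesis rho_gt0 : forall h, (h < m)%N -> 0 < rho h.
Hypothesis rho_lt : forall h h', (h < h')%N -> (h' < m)%N -> rho h < rho h'.

Definition own_value (l h : nat) : R := \sum_(l <= i < h) alpha i.
Definition opp_value (l h : nat) : R := \sum_(l <= i < h) rho i * alpha i.

Lemma rho_le h h' : (h <= h')%N -> (h' < m)%N -> rho h <= rho h'.
Proof. by rewrite leq_eqVlt => /orP[/eqP->//|hh' h'm]; exact/ltW/rho_lt. Qed.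

Lemma own_value_ge0 l h : (h <= m)%N -> 0 <= own_value l h.
Proof.
by move=> hm; rewrite /own_value big_nat sumr_ge0// => i ?; apply/ltW/alpha_gt0; lia.
Qed.

Lemma own_value_gt0 l h : (l < h)%N -> (h <= m)%N -> 0 < own_value l h.
Proof.
move=> lh hm; rewrite /own_value big_ltn// ltr_wpDr//; last by apply: alpha_gt0; lia.
exact: own_value_ge0.
Qed.

Lemma own_value_cat n l h : (l <= n)%N -> (n <= h)%N ->
  own_value l h = own_value l n + own_value n h.
Proof. by move=> ln nh; rewrite /own_value (big_cat_nat ln nh). Qed.

Lemma opp_value_cat n l h : (l <= n)%N -> (n <= h)%N ->
  opp_value l h = opp_value l n + opp_value n h.
Proof. by move=> ln nh; rewrite /opp_value (big_cat_nat ln nh). Qed.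

(** The quotient of [opp_value] by [own_value] is a mean of the ratios [rho i] with weights
    [alpha i]. Through this bound and its mirror image the order of the levels enters the
    inequalities. *)
Lemma opp_value_le c l h : (h <= m)%N ->
  (forall i, (l <= i < h)%N -> rho i <= c) -> opp_value l h <= c * own_value l h.
Proof.
move=> hm rc; rewrite /own_value mulr_sumr; apply: ler_sum_nat => i lih.
by rewrite ler_wpM2r ?rc//; apply/ltW/alpha_gt0; lia.
Qed.

Lemma opp_value_ge c l h : (h <= m)%N ->
  (forall i, (l <= i < h)%N -> c <= rho i) -> c * own_value l h <= opp_value l h.
Proof.
move=> hm rc; rewrite /own_value mulr_sumr; apply: ler_sum_nat => i lih.
by rewrite ler_wpM2r ?rc//; apply/ltW/alpha_gt0; lia.
Qed.

Lemma opp_value_gt0 l h : (l < h)%N -> (h <= m)%N -> 0 < opp_value l h.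
Proof.
move=> lh hm; rewrite (lt_le_trans _ (opp_value_ge (rho l) _ _ _ _))//.
  by rewrite mulr_gt0 ?own_value_gt0//; apply: rho_gt0; lia.
by move=> i ?; apply: rho_le; lia.
Qed.

Lemma own_value_le l h : (l <= h)%N -> (h <= m)%N -> own_value 0 l <= own_value 0 h.
Proof.
by move=> lh hm; rewrite (own_value_cat l 0 h)// lerDl own_value_ge0.
Qed.

(* In an equilibrium with prefix l, bidder i's constraint gives [t <= y <= s / A],
   with A the ratio of opponent to own value on the levels below l; the
   opponent's stability against also winning level [l.-1] gives [t * B < x], with
   B the same ratio on the levels from [l.-1] on; and [x <= rho l * y]. *)
Definition low (s t : R) (l : nat) : bool :=
  (t * opp_value 0 l <= s * own_value 0 l) &&
  ((0 < l < m)%N ==> (t * opp_value 0 l * opp_value l.-1 m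
                      < s * own_value 0 l * own_value l.-1 m * rho l)).

Lemma low_mono s s' t l : (l <= m)%N -> s <= s' -> low s t l -> low s' t l.
Proof.
move=> lm ss' /andP[lw1 /implyP lw2]; apply/andP; split.
  by rewrite (le_trans lw1)// ler_wpM2r// own_value_ge0.
apply/implyP => lm'; rewrite (lt_le_trans (lw2 lm'))//.
rewrite -!mulrA ler_wpM2r// !mulr_ge0 ?own_value_ge0//.
by apply/ltW/rho_gt0; lia.
Qed.

(* The conclusion is the upper bound on s. *)
Lemma low_step s t l : 0 < s -> 0 < t -> (l < m)%N -> ~~ low s t l.+1 ->
  s * own_value l m <= t * opp_value l m /\
  ((0 < l)%N -> s * own_value l m * rho l.-1 * own_value 0 l.+1
                < t * opp_value 0 l.+1 * opp_value l m).
Proof.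
move=> s0 t0 lm; rewrite negb_and -ltNge negb_imply -leNgt /=.
have a1_gt0 : 0 < own_value 0 l.+1 by exact: own_value_gt0.
have k1_gt0 : 0 < opp_value 0 l.+1 by exact: opp_value_gt0.
have k1_le : opp_value 0 l.+1 <= rho l * own_value 0 l.+1.
  by apply: opp_value_le => // i ?; apply: rho_le; lia.
have b_gt0 : 0 < own_value l m by exact: own_value_gt0.
have c_ge : rho l * own_value l m <= opp_value l m.
  by apply: opp_value_ge => // i ?; apply: rho_le; lia.
have r_gt0 := rho_gt0 _ lm.
have r_lt2 : (l.+1 < m)%N -> rho l < rho l.+1 by move=> l1m; exact: rho_lt.
have rl1 : (0 < l)%N -> 0 < rho l.-1 < rho l.
  by move=> l0; rewrite rho_gt0 ?rho_lt//; lia.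
move: (own_value 0 _) (opp_value 0 _) (own_value l _) (opp_value l _) (rho l)
  a1_gt0 k1_gt0 k1_le b_gt0 c_ge r_gt0 rl1 r_lt2
  => a1 k1 b c r a1_gt0 k1_gt0 k1_le b_gt0 c_ge r_gt0 rl1 r_lt2.
have c_gt0 : 0 < c by nra.
(* The second clause of [low] at [l.+1] sums from [l.+1.-1], which is [l], so the failed lower bound
   and both upper bounds concern the same sums. The first clause fails in the first two goals, the
   second clause in the last two. *)
move=> /orP[s_lt|/andP[l1m up]]; split=> [|/rl1 /andP[r'_gt0 r'r]].
- have : s < t * r by rewrite -(ltr_pM2r a1_gt0); nra.
  by nra.
- apply: (lt_le_trans (y := t * k1 * (b * rho l.-1))).
    rewrite -subr_gt0 (_ : _ - _ = (t * k1 - s * a1) * (b * rho l.-1)); last by ring.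
    by rewrite !mulr_gt0// subr_gt0.
  by rewrite ler_pM2l ?mulr_gt0//; nra.
- have r'_gt0 := rho_gt0 _ l1m.
  have rr' := r_lt2 l1m.
  rewrite -(ler_pM2r (mulr_gt0 a1_gt0 r'_gt0)).
  apply: (le_trans (y := t * k1 * c)); first by rewrite (le_trans _ up)//; lra.
  rewrite -!mulrA ler_pM2l// mulrC ler_pM2l//; nra.
- have rr' := r_lt2 l1m.
  apply: lt_le_trans up; rewrite -subr_gt0.
  rewrite (_ : _ - _ = s * a1 * b * (rho l.+1 - rho l.-1)); last by ring.
  by rewrite !mulr_gt0// subr_gt0 (lt_trans r'r).
Qed.

(* The bids (x, y), with targets (s, t), form an equilibrium in which bidder i
   wins exactly the levels below l. *)
Record supports (s t x y : R) (l : nat) : Prop := Supports {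
  own_bid_ge : s <= x;
  opp_bid_ge : t <= y;
  own_wins : forall h, (h < l)%N -> rho h * y < x;
  opp_wins : forall h, (l <= h < m)%N -> x < rho h * y;
  own_feasible : y * opp_value 0 l <= s * own_value 0 l;
  own_maximal : forall h, (l < h <= m)%N -> s * own_value 0 h < y * opp_value 0 h;
  opp_feasible : x * own_value l m <= t * opp_value l m;
  opp_maximal : forall h, (h < l)%N -> t * opp_value h m < x * own_value h m }.

(** Only the adjacent prefixes need checking. If bidder i overspends on [l.+1] levels, then its
    price per value on level [l], the dearest of them, is at least [s], and later levels are dearer
    still. The opponent's price per value rises in the other direction, towards the lower levels. *)
Lemma supportsI s t x y l : 0 < s -> 0 < t -> (l <= m)%N -> s <= x -> t <= y ->
  ((0 < l)%N -> rho l.-1 * y < x /\ t * opp_value l.-1 m < x * own_value l.-1 m) ->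
  ((l < m)%N -> x < rho l * y /\ s * own_value 0 l.+1 < y * opp_value 0 l.+1) ->
  y * opp_value 0 l <= s * own_value 0 l ->
  x * own_value l m <= t * opp_value l m ->
  supports s t x y l.
Proof.
move=> s0 t0 lm sx ty lo up fi fk; have y0 := lt_le_trans t0 ty; have x0 := lt_le_trans s0 sx.
split=> //.
- move=> h hl; have [+ _] := lo (leq_ltn_trans (leq0n h) hl).
  apply: le_lt_trans; rewrite ler_pM2r// rho_le//; first by rewrite -ltnS (ltn_predK hl).
  by rewrite (leq_trans _ lm)// (ltn_predK hl).
- move=> h /andP[lh hm]; have [+ _] := up (leq_ltn_trans lh hm).
  by move=> /lt_le_trans; apply; rewrite ler_pM2r// rho_le.
- move=> h /andP[lh hm]; have lltm := leq_trans lh hm; have [_ up1] := up lltm.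
  rewrite (own_value_cat l.+1)// (opp_value_cat l.+1)// !mulrDr ltr_leD//.
  have k1_le : opp_value 0 l.+1 <= rho l * own_value 0 l.+1.
    by apply: opp_value_le => // i il; apply: rho_le.
  have k_ge : rho l * own_value l.+1 h <= opp_value l.+1 h.
    apply: opp_value_ge => // i /andP[li ih]; apply: rho_le; first exact: ltnW.
    exact: leq_trans ih hm.
  have a1_gt0 : 0 < own_value 0 l.+1 by apply: own_value_gt0.
  have a_ge0 : 0 <= own_value l.+1 h by exact: own_value_ge0.
  have s_le : s <= y * rho l.
    rewrite -(ler_pM2r a1_gt0) (le_trans (ltW up1))// -mulrA ler_pM2l//.
  apply: (le_trans (y := y * rho l * own_value l.+1 h)); first exact: ler_wpM2r.
  by rewrite -mulrA ler_pM2l.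
- move=> h hl; have l_gt0 := leq_ltn_trans (leq0n h) hl; have [_ lo1] := lo l_gt0.
  have hl1 : (h <= l.-1)%N by rewrite -ltnS prednK.
  have l1m : (l.-1 < m)%N by rewrite prednK.
  rewrite (own_value_cat l.-1 h m hl1 (ltnW l1m)) (opp_value_cat l.-1 h m hl1 (ltnW l1m)).
  rewrite !mulrDr ler_ltD//.
  have k1_ge : rho l.-1 * own_value l.-1 m <= opp_value l.-1 m.
    by apply: opp_value_ge => // i /andP[li im]; apply: rho_le.
  have k_le : opp_value h l.-1 <= rho l.-1 * own_value h l.-1.
    by apply: opp_value_le => [|i /andP[_ /ltnW il]]; [exact: ltnW|exact: rho_le].
  have a1_gt0 : 0 < own_value l.-1 m by apply: own_value_gt0.
  have a_ge0 : 0 <= own_value h l.-1 by apply: own_value_ge0; exact: ltnW.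
  have x_ge : t * rho l.-1 <= x.
    by rewrite -(ler_pM2r a1_gt0) (le_trans _ (ltW lo1))// -mulrA ler_pM2l.
  apply: (le_trans (y := t * rho l.-1 * own_value h l.-1)); last exact: ler_wpM2r.
  by rewrite -mulrA ler_pM2l.
Qed.

Lemma supports_exists s t l0 : (0 < m)%N -> 0 < s -> 0 < t -> (l0 <= m)%N -> low s t l0 ->
  exists l x y, (l0 <= l <= m)%N /\ supports s t x y l.
Proof.
move=> m_gt0 s0 t0 l0m lw0.
have exP : exists l, (l <= m)%N && low s t l by exists l0; rewrite l0m.
have ubP l : (l <= m)%N && low s t l -> (l <= m)%N by case/andP.
case: (ex_maxnP exP ubP) => l /andP[lm /andP[low1 low2]] lmax.
exists l; suff [x [y xy]] : exists x y, supports s t x y l.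
  by exists x, y; rewrite lm andbT lmax// l0m.
have [lltm|] := ltnP l m; last first.
  move=> ml; have {ml} lE : l = m by apply/eqP; rewrite eqn_leq lm ml.
  rewrite {}lE in lm low1 low2 lmax *.
  have m1m : (m.-1 < m)%N by rewrite prednK.
  have r_gt0 : 0 < rho m.-1 by exact: rho_gt0.
  (* With every level won, nothing bounds [x] from above: [y] is least and [x] exceeds
     [rho m.-1 * t], the bid at which level [m.-1] costs the opponent exactly its target. *)
  exists (s + rho m.-1 * t), t; apply: supportsI => //; rewrite ?ltnn//.
  - by rewrite lerDl mulr_ge0// ltW.
  - move=> _; split; first by rewrite ltrDr.
    rewrite /opp_value /own_value -{2 5}(prednK m_gt0) !big_nat1.
    by rewrite mulrA ltr_pM2r ?alpha_gt0// mulrC ltrDr.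
  - by rewrite /opp_value /own_value !big_geq// !mulr0.
have [|up1 up2] := low_step s t l s0 t0 lltm.
  by apply/negP => lw; have := lmax l.+1; rewrite lltm lw ltnn => /(_ isT).
case: l lm low1 low2 lmax lltm up1 up2 => [|l'].
  move=> _ _ _ _ _ up1 _; have r_gt0 := rho_gt0 _ m_gt0.
  have tr : s < rho 0 * (t + s / rho 0).
    by rewrite mulrDr mulrCA divff ?gt_eqF// mulr1 ltrDr mulr_gt0.
  (* With no level won, [y] is unbounded above: [x] is least, [y] is large enough to win level 0,
     and [up1] is the opponent's constraint. *)
  exists s, (t + s / rho 0); apply: supportsI => //.
  - by rewrite lerDl divr_ge0 ?ltW.
  - move=> _; split => //.
    by rewrite /opp_value /own_value !big_nat1 mulrA ltr_pM2r ?alpha_gt0// mulrC.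
  - by rewrite /opp_value /own_value !big_geq// !mulr0.
set l := l'.+1 => lm low1 /= low2 _ lltm up1 /(_ isT) up2.
have {}low2 := implyP low2 lltm.
have l'm : (l' < m)%N := ltn_trans (ltnSn _) lltm.
have r_gt0 : 0 < rho l' by exact: rho_gt0.
have r_lt : rho l' < rho l by exact: rho_lt.
have a0_gt0 : 0 < own_value 0 l by exact: own_value_gt0.
have b0_gt0 : 0 < own_value l m by exact: own_value_gt0.
have k0_gt0 : 0 < opp_value 0 l by exact: opp_value_gt0.
have c0_gt0 : 0 < opp_value l m by exact: opp_value_gt0.
have k0_le : opp_value 0 l <= rho l' * own_value 0 l.
  by apply: opp_value_le => // i il; apply: rho_le.
have c0_ge : rho l * own_value l m <= opp_value l m.
  by apply: opp_value_ge => // i /andP[li im]; apply: rho_le.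
have a1E : own_value 0 l.+1 = own_value 0 l + alpha l.
  by rewrite (own_value_cat l)// /own_value big_nat1.
have k1E : opp_value 0 l.+1 = opp_value 0 l + rho l * alpha l.
  by rewrite (opp_value_cat l)// /opp_value big_nat1.
have b1E : own_value l' m = own_value l m + alpha l'.
  by rewrite (own_value_cat l)// /own_value big_nat1 addrC.
have c1E : opp_value l' m = opp_value l m + rho l' * alpha l'.
  by rewrite (opp_value_cat l)// /opp_value big_nat1 addrC.
have al_gt0 := alpha_gt0 _ lltm.
have al'_gt0 := alpha_gt0 _ l'm.
rewrite /= in low2.
have k1_le : opp_value 0 l.+1 <= rho l * own_value 0 l.+1.
  by rewrite a1E k1E mulrDr lerD2r (le_trans k0_le)// ler_pM2r// ltW.
have := fun x y => @supportsI s t x y l s0 t0 lm.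
rewrite /= {}b1E {}c1E {}a1E {}k1E in low2 up2 k1_le *.
move: (own_value 0 l) (own_value l m) (opp_value 0 l) (opp_value l m) (alpha l) (alpha l')
  (rho l') (rho l) r_gt0 r_lt a0_gt0 b0_gt0 k0_gt0 c0_gt0 k0_le c0_ge al_gt0 al'_gt0
  low1 up1 low2 up2 k1_le.
(* Own and opponent values are [a], [k] below [l] and [b], [c] from [l] on; [p], [q] are the own
   values of levels [l], [l'], and [r'], [r] their ratios. *)
move=> a b k c p q r r' r_gt0 rr' a_gt0 b_gt0 k_gt0 c_gt0 k_le c_ge p_gt0 q_gt0 low1 up1
  low2 up2 k1_le supI.
have r'_gt0 : 0 < r' := lt_trans r_gt0 rr'.
have a1_gt0 : 0 < a + p by rewrite addr_gt0.
have b1_gt0 : 0 < b + q by rewrite addr_gt0.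
have k1_gt0 : 0 < k + r' * p by rewrite addr_gt0 ?mulr_gt0.
have rb_lt : r * b < c by apply: lt_le_trans c_ge; rewrite ltr_pM2r.
(* Level [l] strictly raises the mean ratio of the prefix, and level [l'] strictly lowers that of
   the suffix. *)
have avg_own : (a + p) * k < a * (k + r' * p).
  rewrite mulrDl mulrDr ltrD2l mulrA (mulrC p) ltr_pM2r// (le_lt_trans k_le)// mulrC ltr_pM2l//.
have avg_opp : (c + r * q) * b < c * (b + q).
  by rewrite mulrDl mulrDr ltrD2l mulrAC ltr_pM2r.
(* The bounds with [s] are bidder i's stability and constraint; those with divisors [(b + q) * r']
   and [b * r] come from eliminating [x]. Of the six comparisons, [low1], [low2] and [up2] give
   three, and the order of the levels gives the others. *)
have [y [ty y1 y2 y3 y4]] : exists y, [/\ t <= y,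
    s * (a + p) / (k + r' * p) < y, t * (c + r * q) / ((b + q) * r') < y,
    y <= s * a / k & y < t * c / (b * r)].
  apply: between_mixed.
  - by rewrite ler_pdivlMr.
  - by rewrite ltr_pdivlMr ?mulr_gt0// ltr_pM2l// mulrC.
  - by rewrite ltr_pdivrMr// mulrAC ltr_pdivlMr// -!mulrA ltr_pM2l.
  - rewrite ltr_pdivrMr// mulrAC ltr_pdivlMr ?mulr_gt0//.
    by move: up2; congr (_ < _); ring.
  - rewrite ltr_pdivrMr ?mulr_gt0// mulrAC ltr_pdivlMr//.
    by move: low2; congr (_ < _); ring.
  - rewrite ltr_pdivrMr ?mulr_gt0// mulrAC ltr_pdivlMr ?mulr_gt0// -!mulrA ltr_pM2l//.
    rewrite !mulrA; apply: (lt_trans (y := c * (b + q) * r)); first by rewrite ltr_pM2r.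
    by rewrite ltr_pM2l// mulr_gt0.
have y_gt0 := lt_le_trans t0 ty.
rewrite ltr_pdivrMr// in y1; rewrite ltr_pdivrMr ?mulr_gt0// in y2.
rewrite ler_pdivlMr// in y3; rewrite ltr_pdivlMr ?mulr_gt0// in y4.
have [x [sx x1 x2 x3 x4]] : exists x, [/\ s <= x, t * (c + r * q) / (b + q) < x,
    r * y < x, x <= t * c / b & x < r' * y].
  apply: between_mixed.
  - by rewrite ler_pdivlMr.
  - rewrite -(ltr_pM2r a1_gt0) (lt_le_trans y1)// -mulrA mulrCA ler_pM2l//.
  - by rewrite ltr_pdivrMr// mulrAC ltr_pdivlMr// -!mulrA ltr_pM2l.
  - by rewrite ltr_pdivrMr//; move: y2; congr (_ < _); ring.
  - by rewrite ltr_pdivlMr//; move: y4; congr (_ < _); ring.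
  - by rewrite ltr_pM2r.
rewrite ltr_pdivrMr// in x1; rewrite ler_pdivlMr// in x3.
by exists x, y; apply: supI.
Qed.

End Levels.

(** * Grouping queries by value ratio *)

(** The level of a query is the rank of its ratio in the sorted list of distinct ratios. *)
Lemma value_levels (R : realFieldType) (n : nat) (r : 'I_n -> R) :
  exists m (lv : 'I_n -> nat) (rho : nat -> R),
  [/\ forall j, (lv j < m)%N, forall j, r j = rho (lv j),
      forall h, (h < m)%N -> exists j, lv j = h &
      forall h h', (h < h')%N -> (h' < m)%N -> rho h < rho h'].
Proof.
set rs := sort <=%R (undup (codom r)).
have r_in j : r j \in rs by rewrite mem_sort mem_undup codom_f.
have rs_uniq : uniq rs by rewrite sort_uniq undup_uniq.
exists (size rs), (fun j => index (r j) rs), (nth 0 rs); split=> [j|j|h hm|h h' hh' h'm].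
- by rewrite index_mem.
- by rewrite nth_index.
- have /codomP[j rj] : nth 0 rs h \in codom r by rewrite -mem_undup -(mem_sort <=%R) mem_nth.
  by exists j; rewrite -rj index_uniq.
- have rs_sorted : sorted <%R rs by rewrite sort_lt_sorted undup_uniq.
  by rewrite (lt_sorted_ltn_nth 0 rs_sorted) ?inE// (ltn_trans hh').
Qed.

(** * Auction outcomes under uniform bids *)

Lemma other_eq (i : 'I_2) : (other i == i) = false.
Proof. by case: i => [[|[]]]. Qed.

Lemma otherK : involutive other.
Proof. exact: rev_ordK. Qed.

Lemma eq_or_other (i p : 'I_2) : p = i \/ p = other i.
Proof.
by case: i p => [[|[|//]] ?] [[|[|//]] ?];
   (by left; apply: val_inj) || (by right; apply: val_inj).
Qed.

(** Ties favour one fixed bidder, so the weak test of one is the negation of the strict test of the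
    other. *)
Lemma spa_alloc_other (R : realType) n (b : 'M[R]_(2, n)) i j :
  spa_alloc b (other i) j = ~~ spa_alloc b i j.
Proof.
rewrite !mxE otherK; case: (eq_or_other ord0 i) => -> /=.
  by rewrite ltNge.
by rewrite otherK /= leNgt.
Qed.

Section TwoBidders.
Variables (R : realType) (n : nat) (v : 'M[R]_(2, n)) (i : 'I_2).
Variables (m : nat) (lv : 'I_n -> nat) (rho : nat -> R).
Hypothesis v_gt0 : forall p j, 0 < v p j.
Hypothesis lv_lt : forall j, (lv j < m)%N.
Hypothesis lvE : forall j, v (other i) j / v i j = rho (lv j).
Hypothesis lv_onto : forall h, (h < m)%N -> exists j, lv j = h.
Hypothesis rho_lt : forall h h', (h < h')%N -> (h' < m)%N -> rho h < rho h'.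

Let alpha h : R := \sum_(j | lv j == h) v i j.

Let rho_gt0 h : (h < m)%N -> 0 < rho h.
Proof. by move=> /lv_onto[j <-]; rewrite -lvE divr_gt0. Qed.

Let alpha_gt0 h : (h < m)%N -> 0 < alpha h.
Proof.
move=> /lv_onto[j <-]; rewrite /alpha (bigD1 j)//= ltr_wpDr// sumr_ge0// => e _.
exact: ltW.
Qed.

Let opp_valE j : v (other i) j = rho (lv j) * v i j.
Proof. by rewrite -lvE divfK// gt_eqF. Qed.

Let own_gt0 := own_value_gt0 R m alpha alpha_gt0.
Let opp_gt0 := opp_value_gt0 R m alpha rho alpha_gt0 rho_gt0 rho_lt.
Let own_le := own_value_le R m alpha alpha_gt0.
Let rle := rho_le R m rho rho_lt.

Lemma sum_levels (F : 'I_n -> R) l h :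
  \sum_(j | (l <= lv j < h)%N) F j = \sum_(l <= e < h) \sum_(j | lv j == e) F j.
Proof.
rewrite (exchange_big_dep predT)//= big_mkcond/=; apply: eq_bigr => j _.
by under eq_bigl do rewrite eq_sym; rewrite big_nat1_eq.
Qed.

Lemma own_valueE l h :
  \sum_(j | (l <= lv j < h)%N) v i j = own_value R alpha l h.
Proof. exact: sum_levels. Qed.

Lemma opp_valueE l h :
  \sum_(j | (l <= lv j < h)%N) v (other i) j = opp_value R alpha rho l h.
Proof.
rewrite sum_levels; apply: eq_bigr => e _; rewrite mulr_sumr.
by apply: eq_bigr => j /eqP <-; rewrite opp_valE.
Qed.

(** Equilibrium bids and deviations by either bidder all have this form, so one computation of
    values and costs serves them all. *)
Definition linear_bids (b : 'M[R]_(2, n)) (x y : R) : Prop :=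
  forall j, b i j = x * v i j /\ b (other i) j = y * v (other i) j.

Lemma linear_uniform s t mu : linear_bids (uniform_bids v (reports i s t) mu)
  (mu i * s) (mu (other i) * t).
Proof. by move=> j; rewrite !mxE /reports eqxx other_eq. Qed.

Lemma linear_deviate b x y a : linear_bids b x y -> linear_bids (deviate v b i a) a y.
Proof. by move=> bE j; rewrite !mxE eqxx other_eq; have [_ ->] := bE j. Qed.

Lemma linear_deviate_other b x y a :
  linear_bids b x y -> linear_bids (deviate v b (other i) a) x a.
Proof.
by move=> bE j; rewrite !mxE eqxx eq_sym other_eq; have [->] := bE j.
Qed.

Definition wins_below (b : 'M[R]_(2, n)) (l : nat) : Prop :=
  forall j, spa_alloc b i j = (lv j < l)%N.

Section Outcome.
Variables (b : 'M[R]_(2, n)) (x y : R) (l : nat).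
Hypothesis bE : linear_bids b x y.
Hypothesis bl : wins_below b l.

Lemma won_value_own : won_value v (spa_alloc b) i = own_value R alpha 0 l.
Proof. by rewrite -own_valueE; apply: eq_bigl => j; rewrite bl. Qed.

Lemma won_value_opp : won_value v (spa_alloc b) (other i) = opp_value R alpha rho l m.
Proof.
rewrite -opp_valueE; apply: eq_bigl => j.
by rewrite spa_alloc_other bl -leqNgt lv_lt andbT.
Qed.

Lemma spa_cost_own : spa_cost b i = y * opp_value R alpha rho 0 l.
Proof.
rewrite -opp_valueE mulr_sumr; apply: eq_big => [j|j _]; first by rewrite bl.
by rewrite mxE; have [_ ->] := bE j.
Qed.

Lemma spa_cost_opp : spa_cost b (other i) = x * own_value R alpha l m.
Proof.
rewrite -own_valueE mulr_sumr; apply: eq_big => [j|j _].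
  by rewrite spa_alloc_other bl -leqNgt lv_lt andbT.
by rewrite mxE otherK; have [->] := bE j.
Qed.

End Outcome.

Lemma linear_lt b x y j : linear_bids b x y ->
  (b (other i) j < b i j) = (rho (lv j) * y < x).
Proof.
by move=> /(_ j)[-> ->]; rewrite opp_valE mulrA ltr_pM2r// mulrC.
Qed.

Lemma linear_gt b x y j : linear_bids b x y ->
  (b i j < b (other i) j) = (x < rho (lv j) * y).
Proof.
by move=> /(_ j)[-> ->]; rewrite opp_valE mulrA ltr_pM2r// [y * _]mulrC.
Qed.

(** A strict comparison decides the winner under either tie rule, so its uses need not ask which
    bidder [i] is. *)
Lemma alloc_of_lt (b : 'M[R]_(2, n)) j : b (other i) j < b i j -> spa_alloc b i j.
Proof. by move=> bj; rewrite mxE; case: ifP => // _; exact: ltW. Qed.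

Lemma allocN_of_gt (b : 'M[R]_(2, n)) j : b i j < b (other i) j -> ~~ spa_alloc b i j.
Proof. by rewrite -spa_alloc_other !mxE otherK => bj; case: ifP => // _; exact: ltW. Qed.

Lemma wins_belowI b x y l : linear_bids b x y ->
  (forall h, (h < l)%N -> rho h * y < x) ->
  (forall h, (l <= h < m)%N -> x < rho h * y) -> wins_below b l.
Proof.
move=> bE lo up j; have [jl|lj] := ltnP (lv j) l.
  by apply: alloc_of_lt; rewrite (linear_lt b x y)// lo.
by apply/negbTE/allocN_of_gt; rewrite (linear_gt b x y)// up// lj lv_lt.
Qed.

Lemma alloc_le b x y j j0 : 0 < y -> linear_bids b x y -> (lv j <= lv j0)%N ->
  spa_alloc b i j0 -> spa_alloc b i j.
Proof.
move=> y_gt0 bE jj0; rewrite !mxE !(leNgt (b (other i) _)).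
rewrite !(linear_gt b x y)// !(linear_lt b x y)//.
have rjj0 : rho (lv j) * y <= rho (lv j0) * y by rewrite ler_pM2r//; exact: rle.
by case: ifP => _; rewrite -?leNgt; [exact: le_trans|exact: le_lt_trans].
Qed.

(** Even with ties the set of levels won is downward closed. A lost level may be a tie, hence the
    weak inequality. *)
Lemma wins_below_exists b x y : 0 < y -> linear_bids b x y ->
  exists l, [/\ (l <= m)%N, wins_below b l & forall h, (l <= h < m)%N -> x <= rho h * y].
Proof.
(* One past the highest level won; the empty maximum 0 covers the case where nothing is won. *)
move=> y_gt0 bE; pose l := (\max_(j | spa_alloc b i j) (lv j).+1)%N.
have bl : wins_below b l.
  move=> j; apply/idP/idP => [bj|jl].
    by rewrite /l (@leq_bigmax_cond _ _ (fun j => (lv j).+1)).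
  have [/existsP[j0 /andP[bj0 jj0]]|none] :=
    boolP [exists j0, spa_alloc b i j0 && (lv j <= lv j0)%N].
    exact: (alloc_le b x y j j0).
  suff : (l <= lv j)%N by rewrite leqNgt jl.
  apply/bigmax_leqP => j0 bj0; rewrite ltnNge; apply: contra none => jj0.
  by apply/existsP; exists j0; rewrite bj0.
exists l; split=> //.
  by apply/bigmax_leqP => j _; exact: lv_lt.
move=> h /andP[lh /lv_onto[j jh]]; rewrite -jh leNgt -(linear_lt b x y)//.
by apply/negP => /alloc_of_lt; rewrite bl jh ltnNge lh.
Qed.

(** * Passing between equilibria and the linear inequalities *)

Lemma low_of_equilibrium s t mu : 0 < s -> 0 < t ->
  uniform_equilibrium v (reports i s t) mu ->
  exists l, [/\ (l <= m)%N, wins_below (uniform_bids v (reports i s t) mu) l &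
    low R m alpha rho s t l].
Proof.
move=> s_gt0 t_gt0 eqm; have bE := linear_uniform s t mu.
have [] := eqm i; have [] := eqm (other i).
move=> [mu2 fk sk] [mu1 fi si].
have := wins_below_exists _ _ _ _ bE.
move: (mu i * s) (mu (other i) * t) fi fk si sk bE
  (ler_peMl (ltW s_gt0) mu1) (ler_peMl (ltW t_gt0) mu2).
rewrite /tcpa_feasible /stable /= /reports eqxx other_eq -/(reports i s t).
move: (uniform_bids v _ mu) => b x y fi fk si sk bE sx ty.
have y_gt0 := lt_le_trans t_gt0 ty; have x_gt0 := lt_le_trans s_gt0 sx.
move=> /(_ y_gt0)[l [lm bl xl]]; exists l; split=> //.
rewrite (won_value_own _ _ bl) (spa_cost_own _ _ _ _ bE bl) in fi.
have opp_ge0 : 0 <= opp_value R alpha rho 0 l.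
  by case: (posnP l) => [->|l0]; [rewrite /opp_value big_geq|apply/ltW/opp_gt0].
apply/andP; split; first by rewrite (le_trans _ fi)// ler_wpM2r.
apply/implyP => /andP[l_gt0 lltm].
have l1m : (l.-1 < m)%N by rewrite prednK.
(* [q] is the ratio just below level [l.-1], or 0 if that level is the lowest. The deviation [a]
   will make [x / a] the midpoint of [q] and [rho l.-1]. *)
have [q [q_ge0 q_lt q_ge]] : exists q,
    [/\ 0 <= q, q < rho l.-1 & forall h, (h < l.-1)%N -> rho h <= q].
  have [l1|l1] := posnP l.-1.
    by exists 0; rewrite l1; split=> //; apply: rho_gt0; rewrite -l1.
  exists (rho l.-2); split; first by apply/ltW/rho_gt0/(leq_ltn_trans (leq_pred _)).
    by apply: rho_lt; rewrite // prednK.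
  move=> h hl; apply: rle => //; first by rewrite -ltnS prednK.
  exact: leq_ltn_trans (leq_pred _) l1m.
have r_gt0 := rho_gt0 _ l1m.
have d_gt0 : 0 < rho l.-1 + q by rewrite ltr_pwDl.
(* Any bid a with q * a < x < rho l.-1 * a wins exactly the levels from l.-1 on. *)
pose a := x * 2 / (rho l.-1 + q).
have a_gt0 : 0 < a by rewrite divr_gt0// mulr_gt0.
have dE := linear_deviate_other _ _ _ a bE.
have dl : wins_below (deviate v b (other i) a) l.-1.
  apply: wins_belowI dE _ _ => h.
    move=> hl; rewrite /a mulrA ltr_pdivrMr// mulrCA ltr_pM2l//.
    by have := q_ge h hl; lra.
  move=> /andP[hl hm]; rewrite /a mulrA ltr_pdivlMr// mulrCA ltr_pM2l//.
  have : rho l.-1 <= rho h by exact: rle.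
  lra.
(* Level [l.-1] adds positive value for the opponent, so stability can only hold because the
   deviation breaks its constraint. *)
have [] := sk a a_gt0.
  rewrite (won_value_opp _ _ bl) (won_value_opp _ _ dl) ler_pM2l//.
  rewrite (opp_value_cat _ _ _ l)// ?leq_pred// gerDr leNgt opp_gt0//.
  by rewrite prednK.
rewrite (won_value_opp _ _ dl) (spa_cost_opp _ _ _ _ dE dl) => cost.
have k_gt0 : 0 < opp_value R alpha rho 0 l by apply: opp_gt0.
have b_gt0 : 0 < own_value R alpha l.-1 m by apply: own_gt0.
have xr : x <= rho l * y by apply: xl; rewrite leqnn.
(* Three bounds are chained: the excess cost of the deviation, [x <= rho l * y], and bidder i's own
   constraint [fi]. *)
apply: (lt_le_trans (y := opp_value R alpha rho 0 l * (x * own_value R alpha l.-1 m))).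
  by rewrite mulrAC mulrC ltr_pM2l.
apply: (le_trans (y := opp_value R alpha rho 0 l * (rho l * y * own_value R alpha l.-1 m))).
  by rewrite ler_pM2l// ler_pM2r.
rewrite (_ : _ * (rho l * y * _) =
  y * opp_value R alpha rho 0 l * (own_value R alpha l.-1 m * rho l)); last by ring.
by rewrite -[leRHS]mulrA ler_pM2r// mulr_gt0// rho_gt0.
Qed.

(** The multipliers [x / s] and [y / t] produce the bids. Every deviation again yields a prefix,
    possibly with ties, so stability reduces to comparing prefixes: one that gains nothing or one
    that overspends. *)
Lemma equilibrium_of_supports s t x y l : 0 < s -> 0 < t -> (l <= m)%N ->
  supports R m alpha rho s t x y l ->
  exists2 mu, uniform_equilibrium v (reports i s t) mu &
    wins_below (uniform_bids v (reports i s t) mu) l.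
Proof.
move=> s_gt0 t_gt0 lm [sx ty ilo iup ifeas imax kfeas kmax].
have y_gt0 := lt_le_trans t_gt0 ty; have x_gt0 := lt_le_trans s_gt0 sx.
pose mu := reports i (x / s) (y / t).
have bE : linear_bids (uniform_bids v (reports i s t) mu) x y.
  have := linear_uniform s t mu.
  by rewrite /mu /reports eqxx other_eq !divfK ?gt_eqF.
have bl := wins_belowI _ _ _ _ bE ilo iup.
exists mu => //; rewrite /uniform_equilibrium /=.
move: (uniform_bids v _ mu) bE bl => b bE bl p; rewrite /tcpa_feasible /stable.
have [->|->] := eq_or_other i p; rewrite /mu /reports ?eqxx ?other_eq;
  split; rewrite ?ler_pdivlMr ?mul1r//.
- by rewrite (won_value_own _ _ bl) (spa_cost_own _ _ _ _ bE bl).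
- move=> a a_gt0 /=; have dE := linear_deviate _ _ _ a bE.
  have [l' [l'm dl' _]] := wins_below_exists _ _ _ y_gt0 dE.
  rewrite !(won_value_own _ _ bl) !(won_value_own _ _ dl') (spa_cost_own _ _ _ _ dE dl').
  have [l'l|ll'] := leqP l' l; [left|right].
    by rewrite ler_pM2l// own_le.
  by apply: imax; rewrite ll'.
- by rewrite (won_value_opp _ _ bl) (spa_cost_opp _ _ _ _ bE bl).
- move=> a a_gt0 /=; have dE := linear_deviate_other _ _ _ a bE.
  have [l' [l'm dl' _]] := wins_below_exists _ _ _ a_gt0 dE.
  rewrite !(won_value_opp _ _ bl) !(won_value_opp _ _ dl') (spa_cost_opp _ _ _ _ dE dl').
  have [ll'|l'l] := leqP l l'; [left|right; exact: kmax].
  rewrite ler_pM2l// (opp_value_cat _ _ _ l' l)// lerDr.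
  case: (ltngtP l l') ll' => // [ll' _|-> _]; first exact/ltW/opp_gt0.
  by rewrite /opp_value big_geq.
Qed.

(** * Monotonicity in the report *)

Lemma higher_report_wins_more s s' t pi : (0 < m)%N -> 0 < s -> s <= s' -> 0 < t ->
  pi \in eq_allocs v (reports i s t) ->
  exists2 pi', pi' \in eq_allocs v (reports i s' t) & won_value v pi i <= won_value v pi' i.
Proof.
move=> m_gt0 s_gt0 ss' t_gt0; rewrite inE => -[mu eqm ->].
have s'_gt0 := lt_le_trans s_gt0 ss'.
have [l0 [l0m bl0 lw0]] := low_of_equilibrium s t mu s_gt0 t_gt0 eqm.
have lw : low R m alpha rho s' t l0 by apply: low_mono ss' lw0.
have [l [x [y [/andP[l0l lm] sup]]]] :=
  supports_exists R m alpha rho alpha_gt0 rho_gt0 rho_lt s' t l0 m_gt0 s'_gt0 t_gt0 l0m lw.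
have [mu' eqm' bl] := equilibrium_of_supports s' t x y l s'_gt0 t_gt0 lm sup.
exists (spa_alloc (uniform_bids v (reports i s' t) mu')); first by rewrite inE; exists mu'.
by rewrite (won_value_own _ _ bl0) (won_value_own _ _ bl) own_le.
Qed.

End TwoBidders.

Theorem theorem5 (R : realType) (n : nat) (n_ge1 : (1 <= n)%N)
    (v : 'M[R]_(2, n)) (v_gt0 : forall (i : 'I_2) (j : 'I_n), 0 < v i j)
    (i : 'I_2) (T : R) (T_gt0 : 0 < T)
    (S_other : R) (S_other_gt0 : 0 < S_other)
    (T' : R) (T'_gt0 : 0 < T') (T'_le_T : T' <= T) :
  (max_over (eq_allocs v (reports i T S_other)) (LW v i T) >=
   max_over (eq_allocs v (reports i T' S_other)) (LW v i T))%E.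
Proof.
have [m [lv [rho [lv_lt lvE lv_onto rho_lt]]]] :=
  value_levels R n (fun j => v (other i) j / v i j).
have m_gt0 : (0 < m)%N by exact: leq_ltn_trans (lv_lt (Ordinal n_ge1)).
(* The base value [-oo] also settles the case of no equilibrium at [T']. *)
apply: bigmax_le => [|pi pi_eq]; first exact: leNye.
have [pi' pi'_eq le_pi] := higher_report_wins_more _ _ _ _ _ _ _ v_gt0 lv_lt lvE lv_onto rho_lt
  _ _ _ _ m_gt0 T'_gt0 T'_le_T S_other_gt0 pi_eq.
by apply: (bigmax_sup pi') => //; rewrite lee_fin /LW ler_pM2l.
Qed.
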